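(* Let $p\geq 3$ be a prime and $n\geq 3$ an integer. Then $$r_p(\mathbb{F}_p^n)\geq(p-1)^n+\frac{n-2}{2}(p-1)(p-2)^{n-3}.$$
   Context: For a prime $p$ and $n\in\mathbb{N}$, $r_p(\mathbb{F}_p^n)$ denotes the maximum cardinality of a subset of $\mathbb{F}_p^n$ containing no $p$-progression, i.e. no set $\{a+ib : i\in\{0,\dots,p-1\}\}$ with $a,b\in\mathbb{F}_p^n$, $b\neq0$; equivalently, containing no full affine line of $\mathbb{F}_p^n$. *)

(* Defs.v *)
From mathcomp Require Import all_boot all_order all_algebra.

Set Implicit Arguments.
Unset Strict Implicit.
Unset Printing Implicit Defensive.

Import GRing.Theory.
Local Open Scope ring_scope.

Definition progression (p n : nat) (a b : 'rV['F_p]_n) : {set 'rV['F_p]_n} :=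
  [set a + b *+ i | i : 'I_p].

Definition progression_free (p n : nat) (A : {set 'rV['F_p]_n}) : bool :=
  [forall a : 'rV['F_p]_n, forall b : 'rV['F_p]_n,
     (b != 0) ==> ~~ (progression a b \subset A)].

(* For p prime only: 'F_p is the field with p elements exactly in that case. *)
Definition r_ (p n : nat) : nat :=
  (\max_(A : {set 'rV['F_p]_n} | progression_free A) #|A|)%N.

(* Main.v *)
(** Write a vector as (x, z, y_1, ..., y_k), k = n - 2, and let T be the set of
    odd residues, so that T and T + 1 partition the nonzero residues.
    A set of size (p-1)^n without lines arises by querying the coordinates one
    at a time and forbidding for each a single value, where the order and the
    forbidden values may depend on the earlier answers: along a line, the first
    queried coordinate that is not constant takes its forbidden value.
    We use such a set, with every y_j forbidden to be 0, and with the query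
    order of x and z depending on whether some y_j is 1. The forbidden values
    of x and z are tuned so that one may still add all points with x = 1, z in
    T, exactly one y_j equal to 0 and the other y_i outside {0, 1}. There are
    (n-2) (p-1)/2 (p-2)^(n-3) of these.
    A line along which y_j varies has to pass through an added point, where
    y_j = 0 and x = 1. If x is constant, then z avoids 0, hence is a constant
    in T, and the line breaks where y_j = 1. Otherwise x vanishes somewhere,
    which forces x = 1 - y_j, and z then meets a forbidden value because T + 1
    is disjoint from T and does not contain 0. *)

Require Import Defs.
From mathcomp Require Import all_boot all_order all_algebra.
From mathcomp Require Import ring zify.
Set Implicit Arguments.
Unset Strict Implicit.
Import Order.TTheory GRing.Theory Num.Theory.
Local Open Scope ring_scope.

(** * Lines inside the fibered set are constant *)

Section Fiber.
Variables (F : fieldType) (T : pred F) (k : nat).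

Definition lone_zero (j : 'I_k) (y : 'I_k -> F) : bool :=
  [forall i, if i == j then y i == 0 else (y i != 0) && (y i != 1)].

(** The branches are the added points, the query order z then x, and the order x then z. When
    [x = 1 - y j] the forbidden [- x] equals [y j - 1], whichever [j] is the witness. *)
Definition fiber (y : 'I_k -> F) (x z : F) : bool :=
  if [exists j, y j == 0] then [&& [exists j, lone_zero j y], x == 1 & T z]
  else if [exists j, y j == 1] then (z != 0) && (x != (T z)%:R)
  else (x != 0) && (z != if [exists j, x == 1 - y j] then - x else 0).

Lemma lone_zeroP j y : reflect
  (y j = 0 /\ forall i, i != j -> y i != 0 /\ y i != 1) (lone_zero j y).
Proof.
apply: (iffP forallP) => [h|[yj h] i].
  split; first by have := h j; rewrite eqxx => /eqP.
  by move=> i ij; have := h i; rewrite (negPf ij) => /andP.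
by case: eqVneq => [->|/h[-> ->]//]; apply/eqP.
Qed.

Lemma eq_fiber x z y y' : y =1 y' -> fiber y x z = fiber y' x z.
Proof.
move=> e; have e0 c : [exists j, y j == c] = [exists j, y' j == c].
  by apply: eq_existsb => j; rewrite e.
have e1 : [exists j, lone_zero j y] = [exists j, lone_zero j y'].
  by apply: eq_existsb => j; apply: eq_forallb => i; rewrite e.
have e2 : [exists j, x == 1 - y j] = [exists j, x == 1 - y' j].
  by apply: eq_existsb => j; rewrite e.
by rewrite /fiber !e0 e1 e2.
Qed.

Lemma fiber_zero y x z j : fiber y x z -> y j = 0 ->
  [/\ x = 1, T z & forall i, i != j -> y i != 0 /\ y i != 1].
Proof.
rewrite /fiber => + yj; rewrite ifT; last by apply/existsP; exists j; apply/eqP.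
case/and3P=> /existsP[l /lone_zeroP[yl h]] /eqP -> Tz; split=> // i.
have [->|lj] := eqVneq j l; first exact: h.
by have [] := h j lj; rewrite yj eqxx.
Qed.

Lemma fiber_one y x z j : fiber y x z -> y j = 1 -> z != 0 /\ x != (T z)%:R.
Proof.
rewrite /fiber => + yj; case: ifP => [/existsP[i /eqP yi]|_].
  case/and3P=> /existsP[l /lone_zeroP[yl h]] _ _.
  have [jl|/h[_]] := eqVneq j l; last by rewrite yj eqxx.
  by move: yl; rewrite -jl yj => /eqP; rewrite oner_eq0.
by rewrite ifT => [/andP //|]; apply/existsP; exists j; apply/eqP.
Qed.

Lemma fiber_x0 y z : fiber y 0 z -> exists j, y j = 1.
Proof.
rewrite /fiber; case: ifP => _; first by rewrite eq_sym oner_eq0 andbF.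
by case: ifP => [/existsP[j /eqP <-] _|_]; [exists j|rewrite eqxx].
Qed.

Hypothesis T0 : ~~ T 0.

(** At [x = 1] the exceptional forbidden value would require some [y j = 0], so outside the added
    points [z] is always forbidden to be 0. *)
Lemma fiber_x1 y z : fiber y 1 z -> z != 0.
Proof.
rewrite /fiber; case: ifP => [_ /and3P[_ _ Tz]|/existsPn y0].
  by apply: contraNneq T0 => <-.
case: ifP => _ /andP[] // _; rewrite ifF //.
apply/existsP => -[j]; rewrite eq_sym -subr_eq0 addrAC subrr sub0r oppr_eq0.
by rewrite (negPf (y0 j)).
Qed.

Lemma fiber_diag y z j : (forall i, y i != 0) -> (forall i, y i != 1) ->
  fiber y (1 - y j) z -> z != y j - 1.
Proof.
move=> y0 y1; rewrite /fiber ifF; last by apply/existsP => -[i]; apply/negP.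
rewrite ifF; last by apply/existsP => -[i]; apply/negP.
by rewrite ifT ?opprB => [/andP[]//|]; apply/existsP; exists j.
Qed.

(** A nonconstant affine function on a field is onto, so it meets every forbidden value. *)
Lemma affine_avoid (c x d : F) : (forall s, x + s * d != c) -> d = 0.
Proof.
move=> h; apply/eqP; apply: contraT => d0; have := h ((c - x) / d).
by rewrite divfK // addrC subrK eqxx.
Qed.

Hypothesis TS : forall t, T t -> t + 1 != 0 /\ ~~ T (t + 1).

(** Fixing [y] fixes the query order: the coordinate queried first avoids a constant and must be
    constant, and then so is the value forbidden to the other one. *)
Lemma fiber_line_const (y : 'I_k -> F) x dx z dz :
  (forall s, fiber y (x + s * dx) (z + s * dz)) -> dx = 0 /\ dz = 0.
Proof.
move=> h.
have [/existsP[j /eqP yj]|/existsPn y0] := boolP [exists j, y j == 0].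
  split.
    apply: (@affine_avoid 0 x) => s.
    by have [-> _ _] := fiber_zero (h s) yj; exact: oner_neq0.
  apply: (@affine_avoid 0 z) => s.
  by have [_ + _] := fiber_zero (h s) yj; apply: contraTneq => ->.
have [/existsP[j /eqP yj]|/existsPn y1] := boolP [exists j, y j == 1].
  have dz0 : dz = 0.
    by apply: (@affine_avoid 0 z) => s; case: (fiber_one (h s) yj).
  split=> //; apply: (@affine_avoid (T z)%:R x) => s.
  by have := fiber_one (h s) yj; rewrite dz0 mulr0 addr0 => -[].
have h' s : (x + s * dx != 0) && (z + s * dz !=
    if [exists j, x + s * dx == 1 - y j] then - (x + s * dx) else 0).
  have := h s; rewrite /fiber ifF; last by apply/existsP => -[i]; apply/negP.
  by rewrite ifF //; apply/existsP => -[i]; apply/negP.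
have dx0 : dx = 0 by apply: (@affine_avoid 0 x) => s; case/andP: (h' s).
split=> //.
apply: (@affine_avoid (if [exists j, x == 1 - y j] then - x else 0) z) => s.
by have /andP[_] := h' s; rewrite dx0 mulr0 addr0.
Qed.

Lemma fiber_line_normal (y dy : 'I_k -> F) dx z dz j :
  y j = 0 -> dy j = 1 ->
  ~ (forall s, fiber (fun i => y i + s * dy i) (1 + s * dx) (z + s * dz)).
Proof.
move=> yj dyj h.
have yj0 : y j + 0 * dy j = 0 by rewrite yj mul0r addr0.
have [_ + yi0] := fiber_zero (h 0) yj0; rewrite mul0r addr0 => Tz.
have yi i : i != j -> y i != 0 /\ y i != 1 by move/yi0; rewrite mul0r addr0.
have yj1 : y j + 1 * dy j = 1 by rewrite yj dyj mulr1 add0r.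
have [z1 x1] := fiber_one (h 1) yj1; rewrite !mul1r in z1 x1.
have [dx0|dxN0] := eqVneq dx 0.
  have dz0 : dz = 0.
    apply: (@affine_avoid 0 z) => s; apply: (@fiber_x1 (fun i => y i + s * dy i)).
    by have := h s; rewrite dx0 mulr0 addr0.
  by move: x1; rewrite dx0 dz0 !addr0 Tz eqxx.
(* If [y i] varied it would vanish somewhere; there [x = 1], which happens only at [s = 0], where
   [y i] is nonzero. *)
have dyi i : i != j -> dy i = 0.
  move=> ij; apply/eqP; apply: contraT => dyi0.
  have e : y i + (- y i / dy i) * dy i = 0 by rewrite divfK // subrr.
  have [/eqP + _ _] := fiber_zero (h _) e.
  rewrite -subr_eq0 addrAC subrr add0r !mulf_eq0 invr_eq0 oppr_eq0 (negPf dyi0).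
  by rewrite (negPf dxN0) !orbF; have [/negPf->] := yi i ij.
(* Where [x] vanishes some coordinate of [y] is 1; it can only be the [j]-th, so this is at
   [s = 1]. *)
have Edx : dx = -1.
  have x0 : 1 + (- dx^-1) * dx = 0 by rewrite mulNr mulVf // subrr.
  have := h (- dx^-1); rewrite x0 => /fiber_x0[i].
  have [->|ij] := eqVneq i j.
    rewrite yj dyj mulr1 add0r => /eqP; rewrite eqr_oppLR => /eqP.
    by move/(congr1 GRing.inv); rewrite invrK invrN invr1.
  by rewrite (dyi i ij) mulr0 addr0 => /eqP; have [_ /negPf->] := yi i ij.
rewrite Edx subrr in x1.
have Tz1 : T (z + dz) by move: x1; case: (T _) => //; rewrite eqxx.
have [zS TzS] := TS Tz.
have [dz1|dzN1] := eqVneq dz 1; first by rewrite dz1 (negPf TzS) in Tz1.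
have d0 : 1 - dz != 0 by rewrite subr_eq0 eq_sym.
(* [u] solves [z + s * dz = s - 1], so there [z] takes the value forbidden by [fiber_diag]. It is
   nonzero because [z + 1] is, and differs from 1 because [z + dz] is nonzero. *)
set u := (z + 1) / (1 - dz).
have uE : u * (1 - dz) = z + 1 by rewrite divfK.
have u0 : u != 0 by rewrite mulf_neq0 // invr_eq0.
have u1 : u != 1.
  apply: contraNneq z1 => e; move: uE; rewrite e mul1r => /eqP.
  by rewrite subr_eq addrAC -{1}[1]add0r (inj_eq (addIr _)) eq_sym.
have yjE : y j + u * dy j = u by rewrite yj dyj mulr1 add0r.
have := @fiber_diag (fun i => y i + u * dy i) (z + u * dz) j.
rewrite /= yjE => /(_ _ _ _)/negP; apply.
- move=> i; have [->|ij] := eqVneq i j; first by rewrite yjE.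
  by rewrite dyi // mulr0 addr0; case: (yi i ij).
- move=> i; have [->|ij] := eqVneq i j; first by rewrite yjE.
  by rewrite dyi // mulr0 addr0; case: (yi i ij).
- by have := h u; rewrite Edx mulrN1.
by rewrite eq_sym subr_eq addrAC -uE mulrBr mulr1 subrK.
Qed.

Lemma fiber_line (y dy : 'I_k -> F) x dx z dz :
  (forall s, fiber (fun i => y i + s * dy i) (x + s * dx) (z + s * dz)) ->
  [/\ forall i, dy i = 0, dx = 0 & dz = 0].
Proof.
move=> h; have [/existsP[j dyj]|/existsPn dy0] := boolP [exists j, dy j != 0].
  pose s0 := - y j / dy j.
  have yj : y j + s0 * dy j = 0 by rewrite divfK // subrr.
  have [xs _ _] := fiber_zero (h s0) yj.
  (* Reparametrise by [s0 + s / dy j], so that the [j]-th coordinate becomes [s] itself. *)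
  case: (@fiber_line_normal (fun i => y i + s0 * dy i) (fun i => dy i / dy j)
    (dx / dy j) (z + s0 * dz) (dz / dy j) j) => //; first by rewrite divff.
  move=> s; have E c d : c + (s0 + s / dy j) * d = c + s0 * d + s * (d / dy j).
    by rewrite mulrDl addrA -[s / _ * d]mulrA [_^-1 * d]mulrC.
  by have := h (s0 + s / dy j); rewrite !E xs
    (eq_fiber _ _ (fun i => E (y i) (dy i))).
have dyi i : dy i = 0 by apply/eqP; rewrite -[_ == _]negbK.
have [s|-> ->] // := @fiber_line_const y x dx z dz.
have := h s; rewrite (@eq_fiber _ _ _ y) // => i.
by rewrite dyi mulr0 addr0.
Qed.

End Fiber.

(** * Counting the points fiber by fiber *)

Lemma sum_pred (I : finType) (P : pred I) : (\sum_(i : I) P i = #|P|)%N.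
Proof. by rewrite -sum1_card [RHS]big_mkcond. Qed.

Section Count.
Variables (F : finFieldType) (T : pred F) (k : nat).

Lemma sum_neq (c : F) : (\sum_(z : F) (z != c) = #|F|.-1)%N.
Proof. by rewrite sum_pred cardC1. Qed.

Lemma sum_neq_dep (a : F) (c : F -> F) :
  (\sum_(x : F) \sum_(z : F) ((x != a) && (z != c x)) = #|F|.-1 ^ 2)%N.
Proof.
rewrite (eq_bigr (fun x => (x != a) * #|F|.-1)%N) => [|x _].
  by rewrite -big_distrl /= sum_neq.
case: (x != a) => /=; last by rewrite big1.
by rewrite sum_neq mul1n.
Qed.

Lemma card_fiber_ge (y : {ffun 'I_k -> F}) :
  ((y \in ffun_on (predC1 (0%R : F))) * #|F|.-1 ^ 2
     + (\sum_(j < k) lone_zero j y) * \sum_(z : F) T z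
   <= \sum_(x : F) \sum_(z : F) fiber T y x z)%N.
Proof.
have [/existsP[j /eqP yj]|/existsPn y0] := boolP [exists j, y j == 0].
  have -> /= : (y \in ffun_on (predC1 (0%R : F))) = false.
    by apply/ffun_onP => /(_ j); rewrite inE yj eqxx.
  rewrite mul0n add0n.
  have [/existsP[l ly]|/existsPn nly] := boolP [exists l, lone_zero l y].
    (* Two distinct indices cannot both be lone zeros, so the sum over [j] has a single nonzero
       term. *)
    rewrite (bigD1 l) //= ly big1 => [|i il]; last first.
      case: lone_zeroP => // -[yi _]; have /lone_zeroP[_ /(_ i il)[]] := ly.
      by rewrite yi eqxx.
    rewrite addn0 mul1n [X in (_ <= X)%N](bigD1 (1 : F)) //=; apply: leq_trans (leq_addr _ _).
    apply: leq_sum => z _; case Tz: (T z) => //.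
    rewrite /fiber ifT; last by apply/existsP; exists j; apply/eqP.
    by rewrite eqxx Tz !andbT lt0b; apply/existsP; exists l.
  by rewrite big1 // => i _; rewrite (negPf (nly i)).
have -> /= : y \in ffun_on (predC1 (0%R : F)) by apply/ffun_onP => i; rewrite !inE.
rewrite [X in (_ + X * _)%N]big1 => [|i _]; last first.
  by case: lone_zeroP => // -[yi _]; have := y0 i; rewrite yi eqxx.
have yF : [exists j, y j == 0] = false by apply/existsP => -[i]; apply/negP.
rewrite mul0n addn0 mul1n /fiber yF; case: [exists j, y j == 1]; last by rewrite sum_neq_dep.
(* Here [z] is queried first, so the sums are swapped before counting. *)
by rewrite exchange_big /= (sum_neq_dep 0 (fun z => (T z)%:R)).
Qed.

Lemma card_lone_zero (j : 'I_k) :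
  (\sum_(y : {ffun 'I_k -> F}) lone_zero j y = #|F|.-2 ^ k.-1)%N.
Proof.
(* The condition is a product of conditions on single coordinates: one choice at [j], all but two
   elements elsewhere. *)
pose f i : pred F := if i == j then pred1 0 else predC (pred2 0 1).
rewrite (eq_bigr (fun y : {ffun 'I_k -> F} => nat_of_bool (y \in family f)))
  => [|y _].
  rewrite sum_pred card_family.
  have E i : #|f i| = if i == j then 1%N else #|F|.-2.
    rewrite /f; case: eqP => _; first exact: card1.
    by have := cardC (pred2 (0 : F) 1); rewrite card2 eq_sym oner_eq0 => <-.
  rewrite foldrE big_map big_enum /= (eq_bigr _ (fun i _ => E i)).
  rewrite (bigD1 j) //= eqxx mul1n.
  rewrite (eq_bigr (fun=> #|F|.-2)) => [|i /negPf-> //].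
  by rewrite prod_nat_const cardC1 card_ord.
congr nat_of_bool; apply/forallP/familyP => h i; have := h i.
all: by rewrite /f; case: eqP => _; rewrite !inE ?negb_or.
Qed.

Lemma card_fibers_ge :
  (#|F|.-1 ^ k.+2 + k * #|F|.-2 ^ k.-1 * \sum_(z : F) T z
   <= \sum_(y : {ffun 'I_k -> F}) \sum_(x : F) \sum_(z : F) fiber T y x z)%N.
Proof.
apply: leq_trans; last by apply: leq_sum => y _; exact: card_fiber_ge.
rewrite big_split /= -!big_distrl /=; apply/eq_leq; congr (_ + _ * _)%N.
  by rewrite sum_pred card_ffun_on cardC1 card_ord -expnD addn2.
rewrite exchange_big /= (eq_bigr _ (fun j _ => card_lone_zero j)).
by rewrite sum_nat_const card_ord.
Qed.

Definition fiber_set : {set 'rV[F]_(2 + k)} :=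
  [set v : 'rV_(2 + k) | fiber T (fun j => v 0 (rshift 2 j))
                           (v 0 (lshift k 0)) (v 0 (lshift k 1))].

Lemma card_fiber_set_ge :
  (#|F|.-1 ^ k.+2 + k * #|F|.-2 ^ k.-1 * \sum_(z : F) T z <= #|fiber_set|)%N.
Proof.
apply: leq_trans card_fibers_ge _.
pose g (u : {ffun 'I_k -> F} * F * F) : 'rV[F]_(2 + k) :=
  row_mx (\row_(i < 2) if i == 0 then u.1.2 else u.2) (\row_j u.1.1 j).
have gy u j : g u 0 (rshift 2 j) = u.1.1 j by rewrite row_mxEr mxE.
have gx u : g u 0 (lshift k 0) = u.1.2 by rewrite row_mxEl mxE.
have gz u : g u 0 (lshift k 1) = u.2 by rewrite row_mxEl mxE.
have g_inj : injective g.
  move=> [[y x] z] [[y' x'] z'] e; congr (_, _, _).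
  - by apply/ffunP => j; have := gy (y, x, z) j; rewrite e gy.
  - by have := gx (y, x, z); rewrite e gx.
  - by have := gz (y, x, z); rewrite e gz.
rewrite pair_bigA /= pair_bigA /= sum_pred -(card_imset _ g_inj).
apply/subset_leq_card/subsetP => _ /imsetP[u uP ->].
rewrite inE gx gz (eq_fiber _ _ _ (gy u)); exact: uP.
Qed.

End Count.

(** * The odd residues and the final bound *)

Lemma sum_odd (m : nat) : (\sum_(i < m) odd i = m./2)%N.
Proof.
elim: m => [|m IH]; first by rewrite big_ord0.
by rewrite big_ord_recr /= IH uphalf_half addnC.
Qed.

Lemma fiber_set_progression_free (p k : nat) (T : pred 'F_p) :
  prime p -> ~~ T 0 -> (forall t, T t -> t + 1 != 0 /\ ~~ T (t + 1)) ->
  progression_free (fiber_set T k).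
Proof.
move=> p_prime T0 TS; apply/forallP => a; apply/forallP => b.
apply/implyP; apply: contraNN => /subsetP sub.
(* The multiples [b *+ i] with [i < p] are exactly the scalar multiples of [b], so a progression is
   a full line. *)
have h (s : 'F_p) : a + s *: b \in fiber_set T k.
  have sp : (s < p)%N by rewrite -[X in (_ < X)%N](Fp_cast p_prime).
  apply: sub; apply/imsetP; exists (Ordinal sp) => //=.
  by rewrite -{1}[s]natr_Zp scaler_nat.
have [|by0 bx0 bz0] := @fiber_line _ T k T0 TS (fun j => a 0 (rshift 2 j))
  (fun j => b 0 (rshift 2 j)) (a 0 (lshift k 0)) (b 0 (lshift k 0))
  (a 0 (lshift k 1)) (b 0 (lshift k 1)).
  move=> s; have := h s; rewrite inE !mxE.
  by congr (is_true _); apply: eq_fiber => j /=; rewrite !mxE.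
apply/eqP/rowP => i; rewrite mxE; case: (splitP i) => j ij; last first.
  by rewrite -(by0 j); congr (b 0 _); apply: val_inj.
case: j ij => -[|[|//]] j2 /= ij.
  by rewrite -bx0; congr (b 0 _); apply: val_inj.
by rewrite -bz0; congr (b 0 _); apply: val_inj.
Qed.

Theorem theorem1p7 (p n : nat) (p_prime : prime p)
    (p_ge3 : (3 <= p)%N) (n_ge3 : (3 <= n)%N) :
  (p%:R - 1) ^+ n
    + (n%:R - 2) / 2 * (p%:R - 1) * (p%:R - 2) ^+ (n - 3)
  <= (r_ p n)%:R :> rat.
Proof.
case: n n_ge3 => [|[|[|k]]] // _; rewrite !subSS subn0.
pose T (t : 'F_p) := odd t.
have p_odd : odd p by case: (even_prime p_prime) => // p2; rewrite p2 in p_ge3.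
have TS (t : 'F_p) : T t -> t + 1 != 0 /\ ~~ T (t + 1).
  rewrite /T => odd_t.
  have tp : (t < p)%N by rewrite -[X in (_ < X)%N](Fp_cast p_prime).
  (* Since [t] and [p] are both odd, [t] is not [p - 1], so adding 1 does not wrap round to 0. *)
  have t1p : (t.+1 < p)%N.
    by rewrite ltn_neqAle tp andbT; apply: contraTneq p_odd => <-; rewrite /= odd_t.
  have E : nat_of_ord (t + 1) = t.+1.
    by rewrite /= modnDmr addn1 modn_small // [X in (_ < X)%N]Fp_cast.
  by split; [apply: contra_eqN E => /eqP-> | rewrite E /= negbK].
have free := @fiber_set_progression_free p k.+1 T p_prime isT TS.
have le_card : (#|fiber_set T k.+1| <= r_ p k.+3)%N.
  exact: (@leq_bigmax_cond _ _ (fun A : {set 'rV['F_p]_(k.+3)} => #|A|) _ free).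
have := leq_trans (card_fiber_set_ge T k.+1) le_card.
rewrite card_Fp // /T (sum_odd (Zp_trunc (pdiv p)).+2) Fp_cast // => le_r.
rewrite -(ler_nat rat) in le_r; apply: le_trans le_r => {free le_card TS T}.
case: p p_ge3 p_odd {p_prime} => [|[|q]] // _ q_odd.
rewrite ![_.-1]/= natrD natrX 2!natrM natrX.
have -> : q.+2%:R - 1 = q.+1%:R :> rat by rewrite -natr1 addrK.
have -> : q.+2%:R - 2 = q%:R :> rat by rewrite -natrB // subn2.
have -> : k.+3%:R - 2 = k.+1%:R :> rat by rewrite -natrB // subn2.
(* As [p] is odd, the halving is exact and the two bounds coincide. *)
have -> : q.+1%:R = q.+2./2%:R * 2 :> rat by rewrite -natrM; congr _%:R; lia.
by rewrite lerD2l le_eqVlt; apply/orP; left; apply/eqP; field.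
Qed.
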